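(* Let $U$ be a hyporeductive Hopf algebra over $\boldsymbol k$. Then $T(U)_{\rm inn}$ is a hyporeductive triple.
   Context: $\boldsymbol k$ is a field of characteristic zero. A (unital) bialgebra is a vector space $U$ with a bilinear, not necessarily associative product with unit $1$, and a coassociative cocommutative comultiplication $\Delta(u)=u_{(1)}\otimes u_{(2)}$ (Sweedler notation, summation understood) with counit $\epsilon$, such that $\Delta,\epsilon$ are homomorphisms of unital algebras. $\mathrm{Prim}(U)=\{a\mid\Delta(a)=a\otimes1+1\otimes a\}$; $R_a\colon x\mapsto xa$. A non-associative Hopf algebra is a unital bialgebra with bilinear maps $\backslash,/$ satisfying $u_{(1)}\backslash(u_{(2)}v)=\epsilon(u)v=u_{(1)}(u_{(2)}\backslash v)$ and $(uv_{(1)})/v_{(2)}=\epsilon(v)u=(u/v_{(1)})v_{(2)}$. A non-associative Hopf algebra $U$ is hyporeductive if: (right hypospeciality) there is a coalgebra morphism $\circ\colon U\otimes U\to U$ with $u\circ1=\epsilon(u)1=1\circ u$ and $H(u,v)(xy)=H(u_{(1)},v_{(1)})(x)\,H'(u_{(2)},v_{(2)})(y)$ for all $u,v,x,y$, where $r(u,v)(x):=((xu_{(1)})v_{(1)})/(u_{(2)}v_{(2)})$, $H(u,v)(x):=r(u_{(1)},v_{(1)})(x)\,(u_{(2)}\circ v_{(2)})$ and $H'(u,v)(y):=(u_{(1)}\circ v_{(1)})\backslash H(u_{(2)},v_{(2)})(y)$; and (right monoalternativity) $(((xy_{(1)})y_{(2)})\cdots)y_{(n)}=x((y_{(1)}y_{(2)})\cdots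 y_{(n)})$ for all $x,y$ and $n\ge0$ (left-normed products). A triple $(\mathfrak g,\mathfrak s,\mathfrak c)$ consists of a Lie algebra $\mathfrak g$, a subalgebra $\mathfrak s$ and a subspace $\mathfrak c$ with $\mathfrak g=\mathfrak s\oplus\mathfrak c$. It is hyporeductive if $\mathfrak g=N_{\mathfrak g}(\mathfrak c)+\mathfrak c$, where $N_{\mathfrak g}(\mathfrak c)=\{x\in\mathfrak g\mid[x,\mathfrak c]\subseteq\mathfrak c\}$. For a triple $\tau$, $\tau_{\rm inn}=(\mathfrak g_{\rm inn},\mathfrak s_{\rm inn},\mathfrak c)$ with $\mathfrak g_{\rm inn}$ the Lie subalgebra generated by $\mathfrak c$ and $\mathfrak s_{\rm inn}=\mathfrak g_{\rm inn}\cap\mathfrak s$. For a unital bialgebra $U$, $T(U)=(\mathfrak g(U),\mathfrak s(U),\mathfrak c(U))$ where $\mathfrak g(U)=\{f\in\mathrm{End}_{\boldsymbol k}(U)\mid\Delta(f(u))=f(u_{(1)})\otimes u_{(2)}+u_{(1)}\otimes f(u_{(2)})\ \forall u\}$ (commutator bracket), $\mathfrak s(U)=\{f\in\mathfrak g(U)\mid f(1)=0\}$, $\mathfrak c(U)=\{R_a\mid a\in\mathrm{Prim}(U)\}$. *)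

(* Defs.v *)
From HB Require Import structures.
From mathcomp Require Import all_boot all_order all_algebra.
From mathcomp Require Import sesquilinear.
From mathcomp Require Import boolp classical_sets.

Set Implicit Arguments.
Unset Strict Implicit.
Unset Printing Implicit Defensive.

Import GRing.Theory.
Local Open Scope classical_set_scope.
Local Open Scope ring_scope.
Local Open Scope quotient_scope.

Reserved Notation "u ⊗ v" (at level 40, left associativity).
Reserved Notation "x ** y" (at level 40, left associativity).
Reserved Notation "\sw ( a , b <- u ) F"
  (at level 41, a name, b name, u at level 99, F at level 41, right associativity,
   format "\sw ( a ,  b  <-  u )  F").

(* The formal sum u1 ⊗ v1 + ... + un ⊗ vn is encoded by the sequence
   [:: (u1, v1); ...; (un, vn)]; scalars need no slot of their own, since
   they are absorbed by the left factor. *)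
Inductive tensor_eq (k : fieldType) (U V : lmodType k) :
    seq (U * V) -> seq (U * V) -> Prop :=
| tensor_eq_refl s : tensor_eq s s
| tensor_eq_sym s t : tensor_eq s t -> tensor_eq t s
| tensor_eq_trans s t r : tensor_eq s t -> tensor_eq t r -> tensor_eq s r
| tensor_eq_cat s s' t t' :
    tensor_eq s s' -> tensor_eq t t' -> tensor_eq (s ++ t) (s' ++ t')
| tensor_eq_catC s t : tensor_eq (s ++ t) (t ++ s)
| tensor_eq_addl u u' v : tensor_eq [:: (u + u', v)] [:: (u, v); (u', v)]
| tensor_eq_addr u v v' : tensor_eq [:: (u, v + v')] [:: (u, v); (u, v')]
| tensor_eq_scale a u v : tensor_eq [:: (a *: u, v)] [:: (u, a *: v)]
| tensor_eq_zero v : tensor_eq [:: (0, v)] [::].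

Section Tensor.
Variables (k : fieldType) (U V : lmodType k).
Implicit Types (s t : seq (U * V)) (a b : k).

Definition tensor_eqb s t : bool := `[< tensor_eq s t >].

Lemma tensor_eqb_refl : reflexive tensor_eqb.
Proof. by move=> s; apply/asboolP; exact: tensor_eq_refl. Qed.

Lemma tensor_eqb_sym : symmetric tensor_eqb.
Proof. by move=> s t; apply/asboolP/asboolP; exact: tensor_eq_sym. Qed.

Lemma tensor_eqb_trans : transitive tensor_eqb.
Proof.
move=> t s r /asboolP st /asboolP tr.
by apply/asboolP; exact: tensor_eq_trans st tr.
Qed.

Canonical tensor_equiv :=
  EquivRel tensor_eqb tensor_eqb_refl tensor_eqb_sym tensor_eqb_trans.

Definition tensor := {eq_quot tensor_equiv}.
HB.instance Definition _ := Choice.on tensor.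
HB.instance Definition _ := EqQuotient.on tensor.

Lemma tensorP s t : \pi_tensor s = \pi_tensor t <-> tensor_eq s t.
Proof.
split; first by move=> /eqmodP /asboolP.
by move=> st; apply/eqmodP/asboolP.
Qed.

Lemma repr_tensor s : tensor_eq (repr (\pi_tensor s)) s.
Proof. by apply/tensorP; rewrite reprK. Qed.

Definition scale_formal a s := [seq (a *: p.1, p.2) | p <- s].

Lemma scale_formal_eq a s t :
  tensor_eq s t -> tensor_eq (scale_formal a s) (scale_formal a t).
Proof.
elim=> {s t} [s|s t _ IH|s t r _ IH1 _ IH2|s s' t t' _ IH1 _ IH2|s t|u u' v|u v v'|b u v|v] /=.
- exact: tensor_eq_refl.
- exact: tensor_eq_sym.
- exact: tensor_eq_trans IH1 IH2.
- by rewrite /scale_formal !map_cat; exact: tensor_eq_cat.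
- by rewrite /scale_formal !map_cat; exact: tensor_eq_catC.
- by rewrite scalerDr; exact: tensor_eq_addl.
- exact: tensor_eq_addr.
- rewrite scalerA mulrC -scalerA; exact: tensor_eq_scale.
- by rewrite scaler0; exact: tensor_eq_zero.
Qed.

Definition tensor_zero : tensor := \pi_tensor [::].
Definition tensor_add (x y : tensor) : tensor := \pi_tensor (repr x ++ repr y).
Definition tensor_scale a (x : tensor) : tensor :=
  \pi_tensor (scale_formal a (repr x)).
Definition tensor_opp := tensor_scale (-1).

Lemma tensor_addE s t :
  tensor_add (\pi_tensor s) (\pi_tensor t) = \pi_tensor (s ++ t).
Proof. by apply/tensorP; apply: tensor_eq_cat; apply: repr_tensor. Qed.

Lemma tensor_scaleE a s :
  tensor_scale a (\pi_tensor s) = \pi_tensor (scale_formal a s).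
Proof. by apply/tensorP; apply: scale_formal_eq; exact: repr_tensor. Qed.

Lemma tensor_addA : associative tensor_add.
Proof.
move=> x y z; elim/quotW: x => x; elim/quotW: y => y; elim/quotW: z => z.
by rewrite (tensor_addE y z) (tensor_addE x) (tensor_addE x y) (tensor_addE _ z) catA.
Qed.

Lemma tensor_addC : commutative tensor_add.
Proof.
move=> x y; elim/quotW: x => x; elim/quotW: y => y; rewrite !tensor_addE.
by apply/tensorP; exact: tensor_eq_catC.
Qed.

Lemma tensor_add0 : left_id tensor_zero tensor_add.
Proof. by move=> x; elim/quotW: x => x; rewrite tensor_addE. Qed.

Lemma tensor_scaleDl x : {morph tensor_scale^~ x : a b / a + b >-> tensor_add a b}.
Proof.
move=> a b; elim/quotW: x => x; rewrite !tensor_scaleE tensor_addE; apply/tensorP.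
elim: x => [|[u v] s IH] /=; first exact: tensor_eq_refl.
rewrite scalerDl -[_ :: scale_formal (a + b) s]cat1s.
apply: (tensor_eq_trans (tensor_eq_cat (tensor_eq_addl _ _ _) IH)).
rewrite /= -cat1s -[X in tensor_eq _ X]cat1s.
apply: tensor_eq_cat; first exact: tensor_eq_refl.
rewrite -cat1s -[X in tensor_eq _ (_ ++ X)]cat1s !catA.
by apply: tensor_eq_cat; [exact: tensor_eq_catC|exact: tensor_eq_refl].
Qed.

Lemma tensor_scale0 x : tensor_scale 0 x = tensor_zero.
Proof.
elim/quotW: x => x; rewrite tensor_scaleE; apply/tensorP.
elim: x => [|[u v] s IH] /=; first exact: tensor_eq_refl.
rewrite scale0r -[_ :: _]cat1s.
exact: (tensor_eq_cat (tensor_eq_zero _ _) IH).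
Qed.

Lemma tensor_scale1 : left_id 1 tensor_scale.
Proof.
move=> x; elim/quotW: x => x; rewrite tensor_scaleE /scale_formal; congr (\pi_tensor _).
by rewrite -[RHS]map_id; apply: eq_map => -[u v] /=; rewrite scale1r.
Qed.

Lemma tensor_addN : left_inverse tensor_zero tensor_opp tensor_add.
Proof.
move=> x; rewrite -{2}[x]tensor_scale1 -tensor_scaleDl addNr.
exact: tensor_scale0.
Qed.

HB.instance Definition _ :=
  GRing.isZmodule.Build tensor tensor_addA tensor_addC tensor_add0 tensor_addN.

Lemma tensor_scaleA a b x :
  tensor_scale a (tensor_scale b x) = tensor_scale (a * b) x.
Proof.
elim/quotW: x => x; rewrite (tensor_scaleE b) !tensor_scaleE /scale_formal -map_comp.
congr (\pi_tensor _).
by apply: eq_map => -[u v] /=; rewrite scalerA.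
Qed.

Lemma tensor_scaleDr : right_distributive tensor_scale +%R.
Proof.
move=> a x y; elim/quotW: x => x; elim/quotW: y => y.
rewrite [in LHS]/GRing.add /= tensor_addE !tensor_scaleE /scale_formal map_cat.
by rewrite -tensor_addE.
Qed.

HB.instance Definition _ := GRing.Zmodule_isLmodule.Build k tensor
  tensor_scaleA tensor_scale1 tensor_scaleDr tensor_scaleDl.

Definition tens (u : U) (v : V) : tensor := \pi_tensor [:: (u, v)].

Lemma tens_bilinear : bilinear_for *:%R *:%R tens.
Proof.
have tensD u u' v : tens (u + u') v = tens u v + tens u' v.
  by rewrite [RHS]tensor_addE; apply/tensorP; exact: tensor_eq_addl.
have tensDr u v v' : tens u (v + v') = tens u v + tens u v'.
  by rewrite [RHS]tensor_addE; apply/tensorP; exact: tensor_eq_addr.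
have tensZ a u v : tens (a *: u) v = a *: tens u v.
  by rewrite [RHS]tensor_scaleE.
have tensZr a u v : tens u (a *: v) = a *: tens u v.
  rewrite -tensZ; apply/tensorP; apply: tensor_eq_sym.
  exact: tensor_eq_scale.
by split=> [v a u u'|u a v v'] /=; rewrite (tensD, tensDr) (tensZ, tensZr).
Qed.

HB.instance Definition _ :=
  bilinear_isBilinear.Build k U V tensor *:%R *:%R tens tens_bilinear.

Lemma tensor_sum (x : tensor) : x = \sum_(p <- repr x) tens p.1 p.2.
Proof.
rewrite -[LHS]reprK; elim: (repr x) => [|[u v] s IH]; first by rewrite big_nil.
by rewrite big_cons -IH [RHS]tensor_addE.
Qed.

(* The map U ⊗ V -> W sending u ⊗ v to f u v; it is independent of the chosen
   representative when f is bilinear, and a junk value otherwise. *)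
Definition tensor_lift (W : lmodType k) (f : U -> V -> W) (x : tensor) : W :=
  \sum_(p <- repr x) f p.1 p.2.

Section Lift.
Variables (W : lmodType k) (f : U -> V -> W).
Hypothesis f_bilin : bilinear_for *:%R *:%R f.

Lemma tensor_lift_eq s t : tensor_eq s t ->
  \sum_(p <- s) f p.1 p.2 = \sum_(p <- t) f p.1 p.2.
Proof.
have [fl fr] := f_bilin.
elim=> {s t} [s|s t _ IH|s t r _ IH1 _ IH2|s s' t t' _ IH1 _ IH2|s t|u u' v|u v v'|b u v|v] //=.
- by rewrite IH1.
- by rewrite !big_cat /= IH1 IH2.
- by rewrite !big_cat /= addrC.
- by rewrite !big_cons big_nil !addr0 /=; have /= := fl v 1 u u'; rewrite !scale1r.
- by rewrite !big_cons big_nil !addr0 /=; have /= := fr u 1 v v'; rewrite !scale1r.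
- rewrite !big_seq1 /=; have /= -> := scalable_linear (fl v) b u.
  by have /= -> := scalable_linear (fr u) b v.
- rewrite big_seq1 big_nil /=; have /= := scalable_linear (fl v) 0 0.
  by rewrite !scale0r.
Qed.

Lemma tensor_lift_pi s :
  tensor_lift f (\pi_tensor s) = \sum_(p <- s) f p.1 p.2.
Proof. exact: tensor_lift_eq (repr_tensor s). Qed.

Lemma tensor_liftE u v : tensor_lift f (tens u v) = f u v.
Proof. by rewrite tensor_lift_pi big_seq1. Qed.

Lemma tensor_lift_linear : linear (tensor_lift f).
Proof.
move=> a x y; elim/quotW: x => x; elim/quotW: y => y.
rewrite [X in tensor_lift f (X + _)]tensor_scaleE.
rewrite [X in tensor_lift f X]tensor_addE !tensor_lift_pi big_cat /=.
congr (_ + _); rewrite big_map scaler_sumr; apply: eq_bigr => -[u v] _ /=.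
by have [fl _] := f_bilin; have /= -> := scalable_linear (fl v) a u.
Qed.

Lemma tensor_lift_unique (g : {linear tensor -> W}) :
  (forall u v, g (tens u v) = f u v) -> g =1 tensor_lift f.
Proof.
move=> gE x; rewrite {1}[x]tensor_sum linear_sum.
by apply: eq_bigr => p _; rewrite gE.
Qed.

End Lift.
End Tensor.

Notation "U ⊗ V" := (tensor U V) : type_scope.
Notation "u ⊗ v" := (tens u v) : ring_scope.

Record coalgebra (k : fieldType) := Coalgebra {
  coalg_carrier :> lmodType k;
  comul : {linear coalg_carrier -> (coalg_carrier ⊗ coalg_carrier)%type};
  counit : {scalar coalg_carrier};
  _ : forall u, tensor_lift (fun u1 u2 =>
        tensor_lift (fun u11 u12 => u11 ⊗ (u12 ⊗ u2)) (comul u1)) (comul u)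
      = tensor_lift (fun u1 u2 => u1 ⊗ comul u2) (comul u);
  _ : forall u, tensor_lift (fun u1 u2 => counit u1 *: u2) (comul u) = u;
  _ : forall u, tensor_lift (fun u1 u2 => counit u2 *: u1) (comul u) = u }.

(* Sweedler notation: F(u_(1), u_(2)), summation understood. It is meant for F
   bilinear in (u_(1), u_(2)). *)
Notation "\sw ( a , b <- u ) F" :=
  (tensor_lift (fun a b => F) (comul _ u)) : ring_scope.

Record unital_bialgebra (k : fieldType) := UnitalBialgebra {
  bialg_coalgebra :> coalgebra k;
  bmul : {bilinear bialg_coalgebra -> bialg_coalgebra -> bialg_coalgebra};
  bone : bialg_coalgebra;
  _ : forall u, bmul bone u = u;
  _ : forall u, bmul u bone = u;
  _ : forall u, \sw(u1, u2 <- u) (u2 ⊗ u1) = comul bialg_coalgebra u;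
  _ : forall u v, comul bialg_coalgebra (bmul u v) =
        \sw(u1, u2 <- u) \sw(v1, v2 <- v) (bmul u1 v1 ⊗ bmul u2 v2);
  _ : comul bialg_coalgebra bone = bone ⊗ bone;
  _ : forall u v, counit bialg_coalgebra (bmul u v) =
        counit bialg_coalgebra u * counit bialg_coalgebra v;
  _ : counit bialg_coalgebra bone = 1 }.

Notation "x ** y" := (bmul _ x y) : ring_scope.

Record hopf_algebra (k : fieldType) := HopfAlgebra {
  hopf_bialgebra :> unital_bialgebra k;
  ldiv : {bilinear hopf_bialgebra -> hopf_bialgebra -> hopf_bialgebra};
  rdiv : {bilinear hopf_bialgebra -> hopf_bialgebra -> hopf_bialgebra};
  _ : forall u v, \sw(u1, u2 <- u) ldiv u1 (u2 ** v) = counit hopf_bialgebra u *: v;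
  _ : forall u v, \sw(u1, u2 <- u) (u1 ** ldiv u2 v) = counit hopf_bialgebra u *: v;
  _ : forall u v, \sw(v1, v2 <- v) rdiv (u ** v1) v2 = counit hopf_bialgebra v *: u;
  _ : forall u v, \sw(v1, v2 <- v) (rdiv u v1 ** v2) = counit hopf_bialgebra v *: u }.

Section HyporeductiveHopf.
Variables (k : fieldType) (U : hopf_algebra k).
Implicit Types u v x y : U.

Definition hopf_r u v x : U :=
  \sw(u1, u2 <- u) \sw(v1, v2 <- v) rdiv U ((x ** u1) ** v1) (u2 ** v2).

Section Circ.
Variable circ : {bilinear U -> U -> U}.

Definition hopf_H u v x : U :=
  \sw(u1, u2 <- u) \sw(v1, v2 <- v) (hopf_r u1 v1 x ** circ u2 v2).

Definition hopf_H' u v y : U :=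
  \sw(u1, u2 <- u) \sw(v1, v2 <- v) ldiv U (circ u1 v1) (hopf_H u2 v2 y).

(* U ⊗ U carries the coalgebra structure Δ(u ⊗ v) = u1 ⊗ v1 ⊗ u2 ⊗ v2 and
   ε(u ⊗ v) = ε(u) ε(v). *)
Definition coalgebra_morphism2 : Prop :=
  (forall u v, comul U (circ u v) =
     \sw(u1, u2 <- u) \sw(v1, v2 <- v) (circ u1 v1 ⊗ circ u2 v2)) /\
  (forall u v, counit U (circ u v) = counit U u * counit U v).

End Circ.

Definition right_hypospecial : Prop :=
  exists circ : {bilinear U -> U -> U},
    [/\ coalgebra_morphism2 circ,
        forall u, circ u (bone U) = counit U u *: bone U /\
                  circ (bone U) u = counit U u *: bone U
      & forall u v x y, hopf_H circ u v (x ** y) =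
          \sw(u1, u2 <- u) \sw(v1, v2 <- v)
            (hopf_H circ u1 v1 x ** hopf_H' circ u2 v2 y)].

(* (((x y_(1)) y_(2)) ... ) y_(n); the (n+1)-fold comultiplication is the
   n-fold one applied to the first factor of Δ, and the 0-fold one is ε. *)
Fixpoint sweedler_rmul n x y : U :=
  if n is n'.+1 then \sw(y1, y2 <- y) (sweedler_rmul n' x y1 ** y2)
  else counit U y *: x.

(* With x = 1 this is the left-normed product ((y_(1) y_(2)) ... ) y_(n),
   whose value for n = 0 is ε(y) 1. *)
Definition right_monoalternative : Prop :=
  forall n x y, sweedler_rmul n x y = x ** sweedler_rmul n (bone U) y.

Definition hyporeductive_hopf : Prop :=
  right_hypospecial /\ right_monoalternative.

End HyporeductiveHopf.

HB.mixin Record Lmodule_isLie (k : fieldType) L of GRing.Lmodule k L := {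
  lie : L -> L -> L;
  lie_bilinear : bilinear_for *:%R *:%R lie;
  liexx : forall x, lie x x = 0;
  lie_jacobi : forall x y z,
    lie x (lie y z) + lie y (lie z x) + lie z (lie x y) = 0 }.

#[short(type="lieAlgType")]
HB.structure Definition LieAlgebra (k : fieldType) :=
  {L of GRing.Lmodule k L & Lmodule_isLie k L}.

Section Triples.
Variables (k : fieldType) (L : lieAlgType k).
Implicit Types A B : set L.

Definition subspace A : Prop :=
  A 0 /\ forall a x y, A x -> A y -> A (a *: x + y).

Definition lie_subalgebra A : Prop :=
  subspace A /\ forall x y, A x -> A y -> A (lie x y).

Definition sumset A B : set L := [set x + y | x in A & y in B].

(* The Lie algebra of a triple is presented as a subalgebra of an ambient Lie
   algebra L; taking tg = setT gives the case where it is L itself. *)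
Record triple := Triple { tg : set L; ts : set L; tc : set L }.

Definition is_triple (tau : triple) : Prop :=
  [/\ lie_subalgebra (tg tau),
      lie_subalgebra (ts tau),
      subspace (tc tau),
      tg tau = sumset (ts tau) (tc tau)
    & ts tau `&` tc tau = [set 0]].

Definition lie_normalizer (g c : set L) : set L :=
  [set x | g x /\ forall y, c y -> c (lie x y)].

Definition hyporeductive_triple (tau : triple) : Prop :=
  is_triple tau /\
  tg tau = sumset (lie_normalizer (tg tau) (tc tau)) (tc tau).

Definition triple_inn (tau : triple) : triple :=
  let ginn := smallest lie_subalgebra (tc tau) in
  Triple ginn (ginn `&` ts tau) (tc tau).

End Triples.

Section Endomorphisms.
Variables (k : fieldType) (V : lmodType k).

Local Notation End := {linear V -> V}.
Implicit Types f g h : End.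

HB.instance Definition _ := gen_eqMixin End.
HB.instance Definition _ := gen_choiceMixin End.

Lemma endP f g : f =1 g -> f = g.
Proof.
case: f g => [f [[f1] [f2]]] [g [[g1] [g2]]] /= /funext fg.
by case: _ / fg in g1 g2 *; rewrite (Prop_irrelevance f1 g1) (Prop_irrelevance f2 g2).
Qed.

Definition end_zero : End := \0.
Definition end_opp f : End := \- f.
Definition end_add f g : End := f \+ g.

Definition end_scale_fun a f x := a *: f x.

Lemma end_scale_linear a f : linear (end_scale_fun a f).
Proof.
by move=> b x y; rewrite /end_scale_fun linearP scalerDr !scalerA mulrC.
Qed.
HB.instance Definition _ a f :=
  GRing.isLinear.Build k V V *:%R (end_scale_fun a f) (end_scale_linear a f).
Definition end_scale a f : End := end_scale_fun a f.

Lemma end_addA : associative end_add.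
Proof. by move=> f g h; apply: endP => x /=; rewrite addrA. Qed.
Lemma end_addC : commutative end_add.
Proof. by move=> f g; apply: endP => x /=; rewrite addrC. Qed.
Lemma end_add0 : left_id end_zero end_add.
Proof. by move=> f; apply: endP => x /=; rewrite add0r. Qed.
Lemma end_addN : left_inverse end_zero end_opp end_add.
Proof. by move=> f; apply: endP => x /=; rewrite addNr. Qed.

HB.instance Definition _ :=
  GRing.isZmodule.Build End end_addA end_addC end_add0 end_addN.

Lemma end_scaleA a b f : end_scale a (end_scale b f) = end_scale (a * b) f.
Proof. by apply: endP => x; exact: scalerA. Qed.
Lemma end_scale1 : left_id 1 end_scale.
Proof. by move=> f; apply: endP => x; exact: scale1r. Qed.
Lemma end_scaleDr : right_distributive end_scale +%R.
Proof. by move=> a f g; apply: endP => x; exact: scalerDr. Qed.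
Lemma end_scaleDl f : {morph end_scale^~ f : a b / a + b}.
Proof. by move=> a b; apply: endP => x; exact: scalerDl. Qed.

HB.instance Definition _ := GRing.Zmodule_isLmodule.Build k End
  end_scaleA end_scale1 end_scaleDr end_scaleDl.

Lemma end_addE f g x : (f + g) x = f x + g x. Proof. by []. Qed.
Lemma end_oppE f x : (- f) x = - f x. Proof. by []. Qed.
Lemma end_zeroE x : (0 : End) x = 0. Proof. by []. Qed.
Lemma end_scaleE a f x : (a *: f) x = a *: f x. Proof. by []. Qed.

Definition end_comp f g : End := f \o g.

Definition end_lie f g : End := end_comp f g - end_comp g f.

Lemma end_lieE f g x : end_lie f g x = f (g x) - g (f x).
Proof. by []. Qed.

Lemma end_lie_bilinear : bilinear_for *:%R *:%R end_lie.
Proof.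
split=> [h a f g|h a f g]; apply: endP => x;
  rewrite !(end_addE, end_scaleE, end_lieE) !linearP.
  all: by rewrite scalerBr -scalerN; exact: addrACA.
Qed.

Lemma end_liexx f : end_lie f f = 0.
Proof. by apply: endP => x; rewrite end_lieE subrr. Qed.

Lemma end_lie_jacobi f g h :
  end_lie f (end_lie g h) + end_lie g (end_lie h f) + end_lie h (end_lie f g)
  = 0.
Proof.
apply: endP => x.
rewrite -[LHS]/((f (g (h x) - h (g x)) - (g (h (f x)) - h (g (f x))))
  + (g (h (f x) - f (h x)) - (h (f (g x)) - f (h (g x))))
  + (h (f (g x) - g (f x)) - (f (g (h x)) - g (f (h x))))).
rewrite (linearB f) (linearB g) (linearB h) !opprB.
rewrite [LHS](AC ((2*2)*(2*2)*(2*2))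
                 ((1*12)*(2*7)*(3*10)*(4*5)*(6*11)*(8*9)))%AC.
by rewrite /= !(subrr, addNr) !addr0.
Qed.

HB.instance Definition _ := Lmodule_isLie.Build k End
  end_lie_bilinear end_liexx end_lie_jacobi.

End Endomorphisms.

Section BialgebraTriple.
Variables (k : fieldType) (U : unital_bialgebra k).

Definition primitive : set U :=
  [set a | comul U a = a ⊗ bone U + bone U ⊗ a].

Definition right_mul (a : U) : {linear U -> U} := applyr (bmul U) a.

Definition bialg_g : set {linear U -> U} :=
  [set f | forall u,
     comul U (f u) = \sw(u1, u2 <- u) (f u1 ⊗ u2 + u1 ⊗ f u2)].

Definition bialg_s : set {linear U -> U} :=
  [set f | bialg_g f /\ f (bone U) = 0].

Definition bialg_c : set {linear U -> U} := [set right_mul a | a in primitive].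

Definition bialg_triple : triple {linear U -> U} :=
  Triple bialg_g bialg_s bialg_c.

End BialgebraTriple.

(* Main.v *)
Require Import Defs.
From mathcomp Require Import all_boot all_order all_algebra.
From mathcomp Require Import sesquilinear classical_sets.

(** The inner triple is generated by the operators R_a with a primitive, and the
    sum N + c of the normalizer N of c with c is closed under brackets as soon
    as it contains every [R_a, R_b]: N is a subalgebra, [N, c] lies in c, and
    only [c, c] is left to control ([normalizer_decomposition]).

    To write [R_a, R_b] as an element of N + c, evaluate right hypospeciality at
    primitive u = a and v = b. Since Δ(a) = a ⊗ 1 + 1 ⊗ a, the divisions
    disappear and r(a, b) is the associator x |-> (x a) b - x (a b); hence the
    operator
      D(a, b) = H(a, b) = R_b R_a - R_{a b} + R_{a ∘ b}
    obeys D(a, b)(x y) = D(a, b)(x) y + x (D(a, b)(y) - (a ∘ b) y), that is,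
    [D(a, b), R_y] is again a right multiplication R_{y'}
    ([associator_derivation]). The product a b is not primitive, but
    a b - b a is, so
      D(a, b) - D(b, a) = - [R_a, R_b] - R_{a b - b a} + R_{a ∘ b - b ∘ a}
    lies in the inner Lie algebra, and its bracket with R_e, e primitive, is a
    right multiplication R_{e'} satisfying the coderivation rule. Evaluating
    at 1 shows that e' is primitive. Thus D(a, b) - D(b, a) normalizes c and
    differs from - [R_a, R_b] by an element of c.

    The operations r, H, H' and the right-hand side of hypospeciality all have
    the form M (A u_(1) v_(1)) (B u_(2) v_(2)) for bilinear maps M, A, B, as has
    the comultiplication of a product; such expansions are computed once for all,
    on primitive elements and on 1, by the lemmas on [conv]. *)

Set Implicit Arguments.
Unset Strict Implicit.
Unset Printing Implicit Defensive.

Import GRing.Theory.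
Local Open Scope classical_set_scope.
Local Open Scope ring_scope.

(** * Bilinear maps and tensors *)

Notation bilin f := (bilinear_for *:%R *:%R f).

Section Bilinear.
Variable k : fieldType.

Section Rules.
Variables (U V W : lmodType k) (f : U -> V -> W).
Hypothesis f_bilin : bilin f.

Lemma bilinDl u u' v : f (u + u') v = f u v + f u' v.
Proof. by have := f_bilin.1 v 1 u u'; rewrite /= !scale1r. Qed.

Lemma bilinDr u v v' : f u (v + v') = f u v + f u v'.
Proof. by have := f_bilin.2 u 1 v v'; rewrite /= !scale1r. Qed.

Lemma bilin0l v : f 0 v = 0.
Proof. by apply: (addrI (f 0 v)); rewrite -bilinDl !addr0. Qed.

Lemma bilin0r u : f u 0 = 0.
Proof. by apply: (addrI (f u 0)); rewrite -bilinDr !addr0. Qed.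

Lemma bilinZl a u v : f (a *: u) v = a *: f u v.
Proof. by have := f_bilin.1 v a u 0; rewrite /= bilin0l !addr0. Qed.

Lemma bilinZr a u v : f u (a *: v) = a *: f u v.
Proof. by have := f_bilin.2 u a v 0; rewrite /= bilin0r !addr0. Qed.

Lemma tensor_liftP c x y :
  tensor_lift f (c *: x + y) = c *: tensor_lift f x + tensor_lift f y.
Proof. exact: tensor_lift_linear. Qed.

Lemma tensor_liftD x y :
  tensor_lift f (x + y) = tensor_lift f x + tensor_lift f y.
Proof. by have := tensor_liftP 1 x y; rewrite !scale1r. Qed.

Lemma tensor_lift_comp (U' V' : lmodType k) (g : U' -> V' -> (U ⊗ V)%type) x :
  tensor_lift f (tensor_lift g x) = tensor_lift (fun u v => tensor_lift f (g u v)) x.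
Proof.
apply: (big_morph _ tensor_liftD).
by apply: (addrI (tensor_lift f 0)); rewrite -tensor_liftD !addr0.
Qed.

End Rules.

Lemma bilinP (U V W : lmodType k) (f : U -> V -> W) :
  (forall a u u' v, f (a *: u + u') v = a *: f u v + f u' v) ->
  (forall a u v v', f u (a *: v + v') = a *: f u v + f u v') -> bilin f.
Proof. by move=> fl fr; split=> [v a u u'|u a v v'] /=; rewrite ?fl ?fr. Qed.

Lemma bilinear_bilin (U V W : lmodType k) (f : {bilinear U -> V -> W}) : bilin f.
Proof.
by apply: bilinP => a *; [rewrite linearPl | rewrite linearPr].
Qed.

Lemma eq_tensor_lift (U V W : lmodType k) (f g : U -> V -> W) x :
  (forall u v, f u v = g u v) -> tensor_lift f x = tensor_lift g x.
Proof. by move=> fg; apply: eq_bigr => p _; rewrite fg. Qed.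

Lemma tensor_lift_funP (U V W : lmodType k) c (f g : U -> V -> W) x :
  tensor_lift (fun u v => c *: f u v + g u v) x
  = c *: tensor_lift f x + tensor_lift g x.
Proof. by rewrite /tensor_lift scaler_sumr -big_split. Qed.

End Bilinear.

(** * Sweedler sums over primitive elements *)

Section Bialgebra.
Variables (k : fieldType) (U : unital_bialgebra k).
Lemma counit1 : counit U (bone U) = 1.
Proof. by case: U. Qed.

Local Notation "1" := (bone U) : ring_scope.
Implicit Types a b u v x : U.

Lemma bmul1l u : 1 ** u = u. Proof. by case: U u. Qed.
Lemma bmul1r u : u ** 1 = u. Proof. by case: U u. Qed.

Lemma comul_bmul u v :
  comul U (u ** v) = \sw(u1, u2 <- u) \sw(v1, v2 <- v) ((u1 ** v1) ⊗ (u2 ** v2)).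
Proof. by case: U u v. Qed.

Lemma comul1 : comul U 1 = 1 ⊗ 1.
Proof. by case: U. Qed.

Lemma counit_bmul u v : counit U (u ** v) = counit U u * counit U v.
Proof. by case: U u v. Qed.

Lemma counitl u : \sw(u1, u2 <- u) (counit U u1 *: u2) = u.
Proof. by case: (bialg_coalgebra U) u. Qed.

Lemma sweedler1 (W : lmodType k) (F : U -> U -> W) :
  bilin F -> \sw(u1, u2 <- 1) F u1 u2 = F 1 1.
Proof. by move=> FB; rewrite comul1 tensor_liftE. Qed.

Lemma sweedler_prim (W : lmodType k) (F : U -> U -> W) a :
  primitive a -> bilin F -> \sw(u1, u2 <- a) F u1 u2 = F a 1 + F 1 a.
Proof. by move=> -> FB; rewrite tensor_liftD // !tensor_liftE. Qed.

(** The counit axiom gives ε(a) 1 + a = a, so ε(a) 1 = 0; apply ε once more. *)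
Lemma counit_prim a : primitive a -> counit U a = 0.
Proof.
move=> pa; have := counitl a; rewrite sweedler_prim //; last first.
  by apply: bilinP => c *; rewrite ?linearP ?scalerDl ?scalerDr ?scalerA 1?[c * _]mulrC.
rewrite counit1 scale1r => /(canRL (addrK _)); rewrite subrr => /(congr1 (counit U)).
by rewrite linearZ /= counit1 linear0 => <-; rewrite /= [RHS]mulr1.
Qed.

Section Convolution.
Variables (W1 W2 W : lmodType k) (M : W1 -> W2 -> W).
Variables (A : U -> U -> W1) (B : U -> U -> W2).
Hypotheses (MB : bilin M) (AB : bilin A) (BB : bilin B).

(** This is M ∘ (A ⊗ B) applied to the comultiplication of u ⊗ v in the tensor
    product coalgebra. *)
Definition conv u v : W :=
  \sw(u1, u2 <- u) \sw(v1, v2 <- v) M (A u1 v1) (B u2 v2).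

Let convB_inner u1 u2 : bilin (fun v1 v2 => M (A u1 v1) (B u2 v2)).
Proof.
by apply: bilinP => c *;
  rewrite ?(bilinDr AB, bilinZr AB, bilinDr BB, bilinZr BB)
          ?(bilinDl MB, bilinZl MB, bilinDr MB, bilinZr MB).
Qed.

Let convB_outer v1 v2 : bilin (fun u1 u2 => M (A u1 v1) (B u2 v2)).
Proof.
by apply: bilinP => c *;
  rewrite ?(bilinDl AB, bilinZl AB, bilinDl BB, bilinZl BB)
          ?(bilinDl MB, bilinZl MB, bilinDr MB, bilinZr MB).
Qed.

Let convB_sweedler (t : (U ⊗ U)%type) :
  bilin (fun u1 u2 => tensor_lift (fun v1 v2 => M (A u1 v1) (B u2 v2)) t).
Proof.
by apply: bilinP => c *; rewrite -tensor_lift_funP; apply: eq_tensor_lift => v1 v2;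
  have [fl fr] := convB_outer v1 v2; [exact: fl | exact: fr].
Qed.

Lemma conv_bilin : bilin conv.
Proof.
apply: bilinP => [c u u' v|c u v v']; rewrite /conv.
  by rewrite linearP (tensor_liftP (convB_sweedler _)).
rewrite -tensor_lift_funP; apply: eq_tensor_lift => u1 u2.
by rewrite linearP (tensor_liftP (convB_inner _ _)).
Qed.

Lemma conv11 : conv 1 1 = M (A 1 1) (B 1 1).
Proof. by rewrite /conv !sweedler1. Qed.

Lemma conv_prim1 a :
  primitive a -> conv a 1 = M (A a 1) (B 1 1) + M (A 1 1) (B a 1).
Proof. by move=> pa; rewrite /conv sweedler_prim // !sweedler1. Qed.

Lemma conv_1prim b :
  primitive b -> conv 1 b = M (A 1 b) (B 1 1) + M (A 1 1) (B 1 b).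
Proof. by move=> pb; rewrite /conv sweedler1 // sweedler_prim. Qed.

Lemma conv_prim a b : primitive a -> primitive b ->
  conv a b = M (A a b) (B 1 1) + M (A a 1) (B 1 b)
           + (M (A 1 b) (B a 1) + M (A 1 1) (B a b)).
Proof. by move=> pa pb; rewrite /conv !sweedler_prim. Qed.

End Convolution.

(** * Primitive elements and coderivations *)

Lemma coderivation_bilin (f : {linear U -> U}) :
  bilin (fun u1 u2 => f u1 ⊗ u2 + u1 ⊗ f u2).
Proof.
by apply: bilinP => c *; rewrite linearP !(linearPl, linearPr) /= scalerDr addrACA.
Qed.

Lemma primitiveB a b : primitive a -> primitive b -> primitive (a - b).
Proof.
rewrite /primitive /= => pa pb.
by rewrite linearB /= pa pb linearBl linearBr /= opprD addrACA.
Qed.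

Lemma primitive_subspace c a b :
  primitive a -> primitive b -> primitive (c *: a + b).
Proof.
rewrite /primitive /= => pa pb.
by rewrite linearP /= pa pb linearPl linearPr /= scalerDr addrACA.
Qed.

(** In Δ(a b) the mixed terms a ⊗ b + b ⊗ a are symmetric in a and b, hence
    cancel in the commutator. *)
Lemma primitive_commutator a b :
  primitive a -> primitive b -> primitive (a ** b - b ** a).
Proof.
move=> pa pb; have tB := bilinear_bilin (@tens k U U).
have mB := bilinear_bilin (bmul U).
rewrite /primitive /= linearB /= !comul_bmul.
rewrite -!/(conv (@tens k U U) (bmul U) (bmul U) _ _) !conv_prim //.
rewrite !(bmul1l, bmul1r) linearBl linearBr /=.
set p := _ ⊗ 1; set q := a ⊗ b; set r := b ⊗ a; set s := 1 ⊗ _.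
set p' := _ ⊗ 1; set s' := 1 ⊗ _.
rewrite !opprD [LHS](AC ((2*2)*(2*2)) ((1*5)*(4*8)*((2*7)*(3*6)))) /=.
by rewrite !subrr !addr0.
Qed.

Lemma bialg_g_prim (f : {linear U -> U}) : bialg_g f -> primitive (f 1).
Proof.
by move=> fg; rewrite /primitive /= fg sweedler1 //; exact: coderivation_bilin.
Qed.

Lemma right_mulE a x : right_mul a x = x ** a. Proof. by []. Qed.

Lemma right_mul_g a : primitive a -> bialg_g (right_mul a).
Proof.
move=> pa u; rewrite right_mulE comul_bmul; apply: eq_tensor_lift => u1 u2.
rewrite sweedler_prim ?bmul1r ?right_mulE //.
by apply: bilinP => c *; rewrite linearPr (linearPl, linearPr).
Qed.

Lemma right_mulP c a b : right_mul (c *: a + b) = c *: right_mul a + right_mul b.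
Proof. by apply: endP => x; rewrite end_addE end_scaleE !right_mulE linearPr. Qed.

Lemma bialg_g_subspace : subspace (@bialg_g k U).
Proof.
have lift0 : tensor_lift (fun u1 u2 : U => (0 : {linear U -> U}) u1 ⊗ u2
    + u1 ⊗ (0 : {linear U -> U}) u2) =1 fun=> 0.
  by move=> t; apply: big1 => p _; rewrite !end_zeroE linear0l linear0r addr0.
split=> [u|c f g fg gg u]; first by rewrite lift0 end_zeroE linear0.
rewrite end_addE end_scaleE linearP /= fg gg -tensor_lift_funP.
apply: eq_tensor_lift => u1 u2.
by rewrite linearPl linearPr /= scalerDr addrACA.
Qed.

(** For coderivations f and g, Δ(f (g u)) is (f ⊗ 1 + 1 ⊗ f)(g ⊗ 1 + 1 ⊗ g)Δ(u);
    the mixed terms f ⊗ g + g ⊗ f are symmetric in f and g. *)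
Lemma comul_comp (f g : {linear U -> U}) u : bialg_g f -> bialg_g g ->
  comul U (f (g u)) = \sw(u1, u2 <- u)
    (f (g u1) ⊗ u2 + g u1 ⊗ f u2 + (f u1 ⊗ g u2 + u1 ⊗ f (g u2))).
Proof.
move=> fg gg; have fB := coderivation_bilin f.
rewrite fg gg tensor_lift_comp //; apply: eq_tensor_lift => u1 u2.
by rewrite tensor_liftD // !tensor_liftE.
Qed.

Lemma bialg_g_lie (f g : {linear U -> U}) :
  bialg_g f -> bialg_g g -> bialg_g (lie f g).
Proof.
move=> fg gg u; rewrite end_lieE linearB /= !comul_comp // -scaleN1r addrC.
rewrite -tensor_lift_funP.
apply: eq_tensor_lift => u1 u2.
rewrite linearBl linearBr /= scaleN1r addrC !opprD.
set x1 := f (g u1) ⊗ _; set x2 := g u1 ⊗ _; set x3 := f u1 ⊗ _;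
set x4 := u1 ⊗ f _.
set y1 := g (f u1) ⊗ _; set y4 := u1 ⊗ g _.
rewrite [LHS](AC ((2*2)*(2*2)) ((1*5)*(4*8)*((2*7)*(3*6)))) /=.
by rewrite !subrr !addr0.
Qed.

End Bialgebra.

(** * Normalizers in Lie algebras *)

Section LieAlgebra.
Variables (k : fieldType) (L : lieAlgType k).
Implicit Types (A c g : set L).

Lemma lieDl x y z : lie (x + y) z = lie x z + lie y z :> L.
Proof. exact: (bilinDl (@lie_bilinear k L)). Qed.

Lemma lieDr x y z : lie x (y + z) = lie x y + lie x z :> L.
Proof. exact: (bilinDr (@lie_bilinear k L)). Qed.

Lemma lieZl a x y : lie (a *: x) y = a *: lie x y :> L.
Proof. exact: (bilinZl (@lie_bilinear k L)). Qed.

Lemma lie0l x : lie 0 x = 0 :> L.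
Proof. exact: (bilin0l (@lie_bilinear k L)). Qed.

Lemma lieC x y : lie x y = - lie y x :> L.
Proof.
apply/eqP; rewrite -addr_eq0; apply/eqP.
by have := liexx (x + y); rewrite lieDl !lieDr !liexx add0r addr0.
Qed.

Lemma lie_lie x y z : lie (lie x y) z = lie x (lie y z) - lie y (lie x z) :> L.
Proof.
have := lie_jacobi x y z; rewrite [lie z x]lieC [lie z (lie _ _)]lieC.
rewrite -[- lie x z]scaleN1r (bilinZr (@lie_bilinear k L)) scaleN1r.
by move/eqP; rewrite subr_eq0 => /eqP <-.
Qed.

Lemma subspaceD A x y : subspace A -> A x -> A y -> A (x + y).
Proof. by move=> [_ AP] Ax Ay; rewrite -[x]scale1r; exact: AP. Qed.

Lemma subspaceN A x : subspace A -> A x -> A (- x).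
Proof. by move=> [A0 AP] Ax; rewrite -scaleN1r -[_ *: x]addr0; exact: AP. Qed.

Lemma subspaceB A x y : subspace A -> A x -> A y -> A (x - y).
Proof. by move=> sA Ax Ay; apply: subspaceD => //; exact: subspaceN. Qed.

Lemma sumset_subspace A B : subspace A -> subspace B -> subspace (sumset A B).
Proof.
move=> [A0 AP] [B0 BP]; split; first by exists 0 => //; exists 0; rewrite ?addr0.
move=> a _ _ [x Ax [x' Bx' <-]] [y Ay [y' By' <-]].
exists (a *: x + y); first exact: AP.
by exists (a *: x' + y'); [exact: BP | rewrite scalerDr addrACA].
Qed.

Lemma smallest_lie_subalgebra A : lie_subalgebra (smallest (@lie_subalgebra k L) A).
Proof.
have in_sub M x : lie_subalgebra M /\ A `<=` M ->
    smallest (@lie_subalgebra k L) A x -> M x.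
  by move=> [? ?] gx; exact: (smallest_sub _ _ gx).
split=> [|x y gx gy M MA]; last by apply: MA.1.2; exact: in_sub.
split=> [M [[[]]] //|a x y gx gy M MA].
by apply: MA.1.1.2; exact: in_sub.
Qed.

Lemma normalizer_subalgebra g c :
  lie_subalgebra g -> subspace c -> lie_subalgebra (lie_normalizer g c).
Proof.
move=> [[g0 gP] gl] [c0 cP]; split.
  split=> [|a x y [gx nx] [gy ny]]; first by split=> // y _; rewrite lie0l.
  by split=> [|z cz]; [exact: gP | rewrite lieDl lieZl; apply: cP; auto].
move=> x y [gx nx] [gy ny]; split=> [|z cz]; first exact: gl.
by rewrite lie_lie; apply: subspaceB; auto; split.
Qed.

(** N + c is closed under brackets: N is a subalgebra, [N, c] and [c, N] lie in
    c, and [c, c] is covered by the hypothesis. *)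
Lemma normalizer_decomposition c (g := smallest (@lie_subalgebra k L) c)
    (N := lie_normalizer g c) :
  subspace c -> (forall x y, c x -> c y -> sumset N c (lie x y)) ->
  g = sumset N c.
Proof.
move=> sc cc; have gg : lie_subalgebra g := smallest_lie_subalgebra c.
have [sN lN] : lie_subalgebra N := normalizer_subalgebra gg sc.
have cg : c `<=` g := @sub_gen_smallest _ (@lie_subalgebra k L) c.
have sNc := sumset_subspace sN sc.
have cNc x : c x -> sumset N c x.
  by move=> cx; exists 0; [exact: sN.1 | exists x; rewrite ?add0r].
have NNc x : N x -> sumset N c x.
  by move=> Nx; exists x => //; exists 0; [exact: sc.1 | rewrite addr0].
apply/seteqP; split; last first.
  by move=> _ [x [gx _] [y cy <-]]; apply: subspaceD gg.1 gx (cg _ cy).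
apply: smallest_sub => //; split=> // _ _ [x Nx [x' cx' <-]] [y Ny [y' cy' <-]].
rewrite lieDl !lieDr; apply: (subspaceD sNc); apply: (subspaceD sNc).
- by apply: NNc; exact: lN.
- by apply: cNc; exact: Nx.2.
- by rewrite lieC; apply: cNc; apply: subspaceN => //; exact: Ny.2.
- exact: cc.
Qed.

End LieAlgebra.

(** * The inner triple *)

Section InnerTriple.
Variables (k : fieldType) (U : unital_bialgebra k).
Local Notation "1" := (bone U) : ring_scope.
Local Notation ginn := (smallest (@lie_subalgebra k {linear U -> U}) (@bialg_c k U)).

Lemma bialg_c_subspace : subspace (@bialg_c k U).
Proof.
split=> [|c _ _ [a pa <-] [b pb <-]].
  exists 0; first by rewrite /primitive /= !linear0 linear0l linear0r addr0.
  by apply: endP => x; rewrite right_mulE linear0r.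
by exists (c *: a + b); [exact: primitive_subspace | rewrite right_mulP].
Qed.

Lemma inner_sub_g : ginn `<=` @bialg_g k U.
Proof.
apply: smallest_sub; first by split; [exact: bialg_g_subspace | exact: bialg_g_lie].
by move=> _ [a pa <-]; exact: right_mul_g.
Qed.

(** The s-component of f is f - R_{f(1)}: evaluation at 1 maps coderivations to
    primitive elements, and a |-> R_a is a section of it, which also makes the
    sum direct. *)
Lemma inner_is_triple : is_triple (triple_inn (bialg_triple U)).
Proof.
have [sg lg] : lie_subalgebra ginn := smallest_lie_subalgebra _.
have cg : @bialg_c k U `<=` ginn := @sub_gen_smallest _ (@lie_subalgebra k _) _.
split=> /=.
- by split.
- split; last first.
    move=> f h [gf [ff f1]] [gh [hh h1]]; split; first exact: lg.
    by split; [exact: bialg_g_lie | rewrite end_lieE f1 h1 (linear0 f) (linear0 h) subr0].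
  split=> [|c f h [gf [ff f1]] [gh [hh h1]]].
    by split; [exact: sg.1
              | split; [exact: (@bialg_g_subspace k U).1 | exact: end_zeroE]].
  split; first exact: sg.2.
  split; first exact: (@bialg_g_subspace k U).2.
  by rewrite end_addE end_scaleE f1 h1 scaler0 addr0.
- exact bialg_c_subspace.
- apply/seteqP; split=> [f gf | _ [f [gf _] [h ch <-]]]; last first.
    exact: (subspaceD sg gf (cg _ ch)).
  have gf' := inner_sub_g gf; have cf : bialg_c (right_mul (f 1)).
    by exists (f 1) => //; exact: bialg_g_prim.
  have gd : ginn (f - right_mul (f 1)) := subspaceB sg gf (cg _ cf).
  exists (f - right_mul (f 1)); last by exists (right_mul (f 1)); rewrite ?subrK.
  split=> //; split; first exact: inner_sub_g.
  by rewrite end_addE end_oppE right_mulE bmul1l subrr.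
- apply/seteqP; split=> [f [[_ [_ f1]] [a _ af]] | _ ->]; last first.
    split; last exact: bialg_c_subspace.1.
    by split; [exact: sg.1
              | split; [exact: (@bialg_g_subspace k U).1 | exact: end_zeroE]].
  move: f1; rewrite -af right_mulE bmul1l => ->.
  by apply: endP => x; rewrite right_mulE linear0r.
Qed.

End InnerTriple.

(** * Right hypospeciality on primitive elements *)

Section Hopf.
Variables (k : fieldType) (U : hopf_algebra k).
Implicit Types a b u v x y : U.

Lemma ldivK u v : \sw(u1, u2 <- u) ldiv U u1 (u2 ** v) = counit U u *: v.
Proof. by case: U u v. Qed.

Lemma rdivK u v : \sw(v1, v2 <- v) rdiv U (u ** v1) v2 = counit U v *: u.
Proof. by case: U u v. Qed.

Local Notation "1" := (bone U) : ring_scope.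

Let mB : bilin (bmul U) := bilinear_bilin (bmul U).
Let ldivB : bilin (ldiv U) := bilinear_bilin (ldiv U).
Let rdivB : bilin (rdiv U) := bilinear_bilin (rdiv U).

Lemma ldivK_bilin v : bilin (fun u1 u2 => ldiv U u1 (u2 ** v)).
Proof.
by apply: bilinP => c *; [rewrite linearPl | rewrite linearPl linearPr].
Qed.

Lemma rdivK_bilin u : bilin (fun v1 v2 => rdiv U (u ** v1) v2).
Proof.
by apply: bilinP => c *; [rewrite linearPr linearPl | rewrite linearPr].
Qed.

Lemma ldiv1 v : ldiv U 1 v = v.
Proof.
have := ldivK 1 v; rewrite counit1 scale1r sweedler1 ?bmul1l //.
exact: ldivK_bilin.
Qed.

Lemma ldiv_prim a v : primitive a -> ldiv U a v = - (a ** v).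
Proof.
move=> pa; have := ldivK a v; rewrite counit_prim // scale0r.
rewrite sweedler_prim ?bmul1l ?ldiv1 //; last exact: ldivK_bilin.
by move/eqP; rewrite addr_eq0 => /eqP.
Qed.

Lemma rdiv1 u : rdiv U u 1 = u.
Proof.
have := rdivK u 1; rewrite counit1 scale1r sweedler1 ?bmul1r //.
exact: rdivK_bilin.
Qed.

Lemma rdiv_prim u a : primitive a -> rdiv U u a = - (u ** a).
Proof.
move=> pa; have := rdivK u a; rewrite counit_prim // scale0r.
rewrite sweedler_prim ?bmul1r ?rdiv1 //; last exact: rdivK_bilin.
by move/eqP; rewrite addrC addr_eq0 => /eqP.
Qed.

(** Obtained by solving (u (a b)_(1)) / (a b)_(2) = 0 for its last term u / (a b),
    the other divisors being 1, a and b. *)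
Lemma rdiv_prim_mul u a b : primitive a -> primitive b ->
  rdiv U u (a ** b) = (u ** a) ** b + (u ** b) ** a - u ** (a ** b).
Proof.
move=> pa pb; have := rdivK u (a ** b).
have FB := rdivK_bilin u.
rewrite counit_bmul (counit_prim pa) mul0r scale0r comul_bmul.
rewrite -/(conv (@tens k U U) (bmul U) (bmul U) _ _).
rewrite conv_prim //; last exact: bilinear_bilin.
rewrite !(tensor_liftD FB) !tensor_liftE // !(bmul1l, bmul1r) rdiv1.
rewrite (rdiv_prim _ pa) (rdiv_prim _ pb) addrA => /eqP.
rewrite addrC addr_eq0 => /eqP ->.
by rewrite !opprD !opprK -addrA addrC.
Qed.

Lemma hopf_rE u v x :
  hopf_r u v x = conv (rdiv U) (fun u1 v1 => x ** u1 ** v1) (bmul U) u v.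
Proof. by []. Qed.

Lemma mul2_bilin x : bilin (fun u1 v1 => x ** u1 ** v1).
Proof.
by apply: bilinP => c *; [rewrite linearPr linearPl | rewrite linearPr].
Qed.
Local Hint Resolve mul2_bilin : core.

Lemma hopf_r_bilin x : bilin (fun u v => hopf_r u v x).
Proof. exact: conv_bilin. Qed.

Lemma hopf_r11 x : hopf_r 1 1 x = x.
Proof. by rewrite hopf_rE conv11 // !bmul1r rdiv1. Qed.

Lemma hopf_r_prim1 a x : primitive a -> hopf_r a 1 x = 0.
Proof.
by move=> pa; rewrite hopf_rE conv_prim1 // !bmul1r rdiv1 rdiv_prim // subrr.
Qed.

Lemma hopf_r_1prim b x : primitive b -> hopf_r 1 b x = 0.
Proof.
by move=> pb; rewrite hopf_rE conv_1prim // !(bmul1r, bmul1l) rdiv1 rdiv_prim // subrr.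
Qed.

(** The two terms with a and b on opposite sides of the division cancel against
    those of x / (a b), and only the associator remains. *)
Lemma hopf_r_prim a b x : primitive a -> primitive b ->
  hopf_r a b x = (x ** a) ** b - x ** (a ** b).
Proof.
move=> pa pb; rewrite hopf_rE conv_prim // !(bmul1r, bmul1l) rdiv1.
rewrite (rdiv_prim _ pa) (rdiv_prim _ pb) rdiv_prim_mul // subrr add0r.
by rewrite [_ + _ - _]addrAC [X in _ + X]addrC addKr.
Qed.

Section Circ.
Variable circ : {bilinear U -> U -> U}.
Hypothesis circ_coalg : coalgebra_morphism2 circ.
Hypothesis circ1 : forall u,
  circ u 1 = counit U u *: 1 /\ circ 1 u = counit U u *: 1.
Hypothesis hypospecial : forall u v x y, hopf_H circ u v (x ** y) =
  \sw(u1, u2 <- u) \sw(v1, v2 <- v)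
    (hopf_H circ u1 v1 x ** hopf_H' circ u2 v2 y).

Let circB : bilin circ := bilinear_bilin circ.
Local Notation H := (hopf_H circ).
Local Notation H' := (hopf_H' circ).

Lemma circ11 : circ 1 1 = 1.
Proof. by rewrite (circ1 1).1 counit1 scale1r. Qed.

Lemma circ_prim1 a : primitive a -> circ a 1 = 0.
Proof. by move=> pa; rewrite (circ1 a).1 counit_prim // scale0r. Qed.

Lemma circ_1prim b : primitive b -> circ 1 b = 0.
Proof. by move=> pb; rewrite (circ1 b).2 counit_prim // scale0r. Qed.

(** The mixed terms of Δ(a ∘ b) contain a factor a ∘ 1 or 1 ∘ a, and so vanish. *)
Lemma circ_primitive a b : primitive a -> primitive b -> primitive (circ a b).
Proof.
move=> pa pb; rewrite /primitive /= circ_coalg.1.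
rewrite -/(conv (@tens k U U) circ circ a b) conv_prim //; last exact: bilinear_bilin.
rewrite circ11 !circ_prim1 // !circ_1prim //.
by rewrite !(linear0l, linear0r) addr0 add0r.
Qed.

Lemma hopf_HE u v x : H u v x = conv (bmul U) (fun u1 v1 => hopf_r u1 v1 x) circ u v.
Proof. by []. Qed.

Let rB x := hopf_r_bilin x.

Lemma hopf_H_bilin x : bilin (fun u v => H u v x).
Proof. exact: conv_bilin. Qed.
Let HB x := hopf_H_bilin x.

Lemma hopf_H11 x : H 1 1 x = x.
Proof. by rewrite hopf_HE conv11 // hopf_r11 circ11 bmul1r. Qed.

Lemma hopf_H_prim1 a x : primitive a -> H a 1 x = 0.
Proof.
move=> pa; rewrite hopf_HE conv_prim1 // (hopf_r_prim1 _ pa) (circ_prim1 pa).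
by rewrite linear0l linear0r addr0.
Qed.

Lemma hopf_H_1prim b x : primitive b -> H 1 b x = 0.
Proof.
move=> pb; rewrite hopf_HE conv_1prim // (hopf_r_1prim _ pb) (circ_1prim pb).
by rewrite linear0l linear0r addr0.
Qed.

Lemma hopf_H_prim a b x : primitive a -> primitive b ->
  H a b x = (x ** a) ** b - x ** (a ** b) + x ** circ a b.
Proof.
move=> pa pb; rewrite hopf_HE conv_prim // circ11 bmul1r hopf_r11.
rewrite (circ_prim1 pa) (circ_1prim pb) !linear0r addr0 add0r.
by rewrite hopf_r_prim.
Qed.

Lemma hopf_H'E u v y : H' u v y = conv (ldiv U) circ (fun u2 v2 => H u2 v2 y) u v.
Proof. by []. Qed.

Lemma hopf_H'_bilin y : bilin (fun u v => H' u v y).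
Proof. exact: conv_bilin. Qed.
Let H'B y := hopf_H'_bilin y.

Lemma hopf_H'11 y : H' 1 1 y = y.
Proof. by rewrite hopf_H'E conv11 // circ11 hopf_H11 ldiv1. Qed.

Lemma hopf_H'_prim a b y : primitive a -> primitive b ->
  H' a b y = H a b y - circ a b ** y.
Proof.
move=> pa pb; rewrite hopf_H'E conv_prim // circ11 hopf_H11 ldiv1.
rewrite (circ_prim1 pa) (circ_1prim pb) !linear0l addr0 add0r.
by rewrite (ldiv_prim _ (circ_primitive pa pb)) addrC.
Qed.

(** In the expansion of H(a, b)(x y), only the terms in which a and b are
    in the same tensor factor survive, because H(a, 1) = H(1, b) = 0. *)
Lemma associator_derivation a b x y : primitive a -> primitive b ->
  H a b (x ** y) = H a b x ** y + x ** (H a b y - circ a b ** y).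
Proof.
move=> pa pb; rewrite hypospecial.
rewrite -/(conv (bmul U) (fun u1 v1 => H u1 v1 x) (fun u2 v2 => H' u2 v2 y) a b).
rewrite conv_prim // hopf_H'11 hopf_H11 (hopf_H_prim1 _ pa) (hopf_H_1prim _ pb).
by rewrite !linear0l addr0 add0r hopf_H'_prim.
Qed.

(** The component in the normalizer is D = H(b, a) - H(a, b). Antisymmetrizing
    replaces the right multiplication by a b, which need not be primitive, with
    that by the commutator, so that D belongs to the inner Lie algebra; the
    derivation property makes [D, R_e] a right multiplication. *)
Lemma lie_right_mul a b (c := @bialg_c k U)
    (g := smallest (@lie_subalgebra k {linear U -> U}) c) :
  primitive a -> primitive b ->
  sumset (lie_normalizer g c) c (lie (right_mul a) (right_mul b)).
Proof.
move=> pa pb; have gg : lie_subalgebra g := smallest_lie_subalgebra _.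
have cg : c `<=` g := @sub_gen_smallest _ (@lie_subalgebra k _) _.
pose w : U := (circ a b - circ b a) - (a ** b - b ** a).
have pw : primitive w.
  by apply: primitiveB; [apply: primitiveB; exact: circ_primitive
                        | exact: primitive_commutator].
pose D : {linear U -> U} := lie (right_mul a) (right_mul b) - right_mul w.
have DE x : D x = H b a x - H a b x.
  rewrite end_addE end_oppE end_lieE !right_mulE !hopf_H_prim // !linearBr /=.
  rewrite !opprD !opprK.
  by rewrite [LHS](AC (2*(2*2)) (((1*6)*4)*((2*5)*3))).
have gD : g D.
  apply: subspaceB gg.1 _ _; last by apply: cg; exists w.
  by apply: gg.2; apply: cg; [exists a | exists b].
exists D; last by exists (right_mul w); [exists w | rewrite subrK].
split=> // _ [e pe <-].
pose e' := (H b a e - circ b a ** e) - (H a b e - circ a b ** e).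
have De : lie D (right_mul e) = right_mul e'.
  apply: endP => x; rewrite end_lieE !right_mulE !DE !associator_derivation //.
  rewrite linearBl [RHS]linearBr /= opprB opprD.
  by rewrite [LHS](AC ((2*2)*2) ((2*4)*((1*6)*(5*3)))) /= !subrr !addr0.
rewrite De; exists e' => //.
(* e' is the value at 1 of the coderivation [D, R_e]. *)
rewrite -[e']bmul1l -right_mulE -De; apply: bialg_g_prim; apply: inner_sub_g.
by apply: gg.2 => //; apply: cg; exists e.
Qed.

End Circ.
End Hopf.

Theorem proposition4p4 (k : fieldType) (hk : [pchar k]%R =i pred0)
    (U : hopf_algebra k) :
  hyporeductive_hopf U -> hyporeductive_triple (triple_inn (bialg_triple U)).
Proof.
move=> [[circ [circ_coalg circ1 hypospecial]] _]; split; first exact: inner_is_triple.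
apply: normalizer_decomposition (bialg_c_subspace U) _ => _ _ [a pa <-] [b pb <-].
exact: lie_right_mul circ_coalg circ1 hypospecial _ _ pa pb.
Qed.
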